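(* For every positive integer $m$, as formal power series in $q$ (with coefficients polynomials in $b$), \[ \sum_{k=1}^{\infty}(-1)^{k-1}\frac{b^k q^{\frac{k(k+1)}{2}+(m-1)k}}{(bq;q)_k(1-q^k)^m} =\sum_{j_1=1}^{\infty}\frac{b^{j_1}q^{j_1}}{1-q^{j_1}}\sum_{j_2=1}^{j_1}\frac{q^{j_2}}{1-q^{j_2}}\cdots\sum_{j_m=1}^{j_{m-1}}\frac{q^{j_m}}{1-q^{j_m}}. \]
   Context: For indeterminates $a,q$ and $k\ge 1$, $(a;q)_k=(1-a)(1-aq)(1-aq^2)\cdots(1-aq^{k-1})$; thus $(bq;q)_k=\prod_{i=1}^k(1-bq^i)$. $b$ is an indeterminate. *)

(* Defs.v *)
From HB Require Import structures.
From mathcomp Require Import all_boot all_order all_algebra.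
From mathcomp Require Import boolp.

Set Implicit Arguments.
Unset Strict Implicit.
Unset Printing Implicit Defensive.

Import GRing.Theory.
Local Open Scope ring_scope.

(* Formal power series in one variable; a series coerces to its coefficient
   sequence, so [s n] is the coefficient of the n-th power of the variable. *)
Record fps (R : Type) := Fps { fps_coef :> nat -> R }.

HB.instance Definition _ (R : Type) := gen_eqMixin (fps R).
HB.instance Definition _ (R : Type) := gen_choiceMixin (fps R).

Lemma fpsP (R : Type) (s t : fps R) : s =1 t -> s = t.
Proof. by case: s t => [f] [g] /= /funext ->. Qed.

Section FpsZmod.
Variable R : zmodType.
Implicit Types s t : fps R.

Definition fps_zero : fps R := Fps (fun=> 0).
Definition fps_opp s := Fps (fun n => - s n).
Definition fps_add s t := Fps (fun n => s n + t n).

Fact fps_addA : associative fps_add.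
Proof. by move=> s t u; apply: fpsP => n; rewrite /= addrA. Qed.
Fact fps_addC : commutative fps_add.
Proof. by move=> s t; apply: fpsP => n; rewrite /= addrC. Qed.
Fact fps_add0 : left_id fps_zero fps_add.
Proof. by move=> s; apply: fpsP => n; rewrite /= add0r. Qed.
Fact fps_addN : left_inverse fps_zero fps_opp fps_add.
Proof. by move=> s; apply: fpsP => n; rewrite /= addNr. Qed.

HB.instance Definition _ := GRing.isZmodule.Build (fps R)
  fps_addA fps_addC fps_add0 fps_addN.

End FpsZmod.

Section FpsComRing.
Variable R : comNzRingType.
Implicit Types s t : fps R.

Definition fpsC (c : R) : fps R := Fps (fun n => if n is 0%N then c else 0).

Definition fpsX : fps R := Fps (fun n => (n == 1%N)%:R).

Definition fps_mul s t : fps R :=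
  Fps (fun n => \sum_(i < n.+1) s i * t (n - i)%N).

Definition fps_trunc (N : nat) s : {poly R} := \poly_(i < N) s i.

Lemma fps_mul_trunc N s t n : (n < N)%N ->
  fps_mul s t n = (fps_trunc N s * fps_trunc N t)`_n.
Proof.
move=> ltnN; rewrite coefM; apply: eq_bigr => i _.
rewrite !coef_poly (leq_ltn_trans (leq_subr _ _) ltnN).
by rewrite (leq_ltn_trans _ ltnN) // -ltnS.
Qed.

Fact fps_mulC : commutative fps_mul.
Proof.
by move=> s t; apply: fpsP => n; rewrite !(fps_mul_trunc _ _ (ltnSn n)) mulrC.
Qed.

Fact fps_mulA : associative fps_mul.
Proof.
move=> s t u; apply: fpsP => n.
pose T := fps_trunc n.+1.
transitivity ((T s * (T t * T u))`_n).
  rewrite coefM; apply: eq_bigr => i _.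
  rewrite (fps_mul_trunc t u (_ : n - i < n.+1)%N) ?ltnS ?leq_subr //.
  by rewrite coef_poly ltn_ord.
rewrite mulrA coefM; apply: eq_bigr => i _.
by rewrite (fps_mul_trunc s t (ltn_ord i)) coef_poly ltnS leq_subr.
Qed.

Fact fps_mul1 : left_id (fpsC 1) fps_mul.
Proof.
move=> s; apply: fpsP => n /=; rewrite big_ord_recl /= mul1r subn0 big1 ?addr0 //.
by move=> i _; rewrite mul0r.
Qed.

Fact fps_mulDl : left_distributive fps_mul (@fps_add R).
Proof.
move=> s t u; apply: fpsP => n /=; rewrite -big_split.
by apply: eq_bigr => i _; rewrite mulrDl.
Qed.

Fact fps_one_neq0 : fpsC 1 != 0.
Proof.
by apply/eqP => /(congr1 (fun s : fps R => s 0%N)) /eqP; rewrite oner_eq0.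
Qed.

HB.instance Definition _ := GRing.Zmodule_isComNzRing.Build (fps R)
  fps_mulA fps_mulC fps_mul1 fps_mulDl fps_one_neq0.

Lemma fps_coefM s t n : (s * t) n = \sum_(i < n.+1) s i * t (n - i)%N.
Proof. by []. Qed.

(* Convergence for the topology in which each coefficient is eventually
   constant: [s] is the sum of the series u 1 + u 2 + u 3 + ... *)
Definition fps_is_sum1 (u : nat -> fps R) (s : fps R) : Prop :=
  forall n : nat, exists K : nat, forall M : nat, (K <= M)%N ->
    (\sum_(1 <= k < M.+1) u k) n = s n.

Lemma fps_is_sum1_unique u s t : fps_is_sum1 u s -> fps_is_sum1 u t -> s = t.
Proof.
move=> us ut; apply: fpsP => n.
have [K Ks] := us n; have [L Lt] := ut n.
by rewrite -(Ks (maxn K L)) ?leq_maxl // -(Lt (maxn K L)) ?leq_maxr.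
Qed.

End FpsComRing.

Arguments fpsX {R}.

Section FpsUnit.
Variable R : comUnitRingType.
Implicit Types s t : fps R.

Definition fps_unit : {pred fps R} := fun s => s 0%N \is a GRing.unit.

(* The coefficients of the inverse, from index n down to 0. *)
Fixpoint fps_inv_seq s (n : nat) : seq R :=
  if n is n'.+1 then
    let r := fps_inv_seq s n' in
    (- ((s 0%N)^-1 * \sum_(i < n'.+1) s i.+1 * r`_i)) :: r
  else [:: (s 0%N)^-1].

Definition fps_inv s : fps R :=
  if s \in fps_unit then Fps (fun n => (fps_inv_seq s n)`_0) else s.

Lemma fps_inv_seqE s n i : (i <= n)%N ->
  (fps_inv_seq s n)`_i = (fps_inv_seq s (n - i))`_0.
Proof.
elim: n i => [|n IHn] [|i] //= lein.
by rewrite subSS IHn.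
Qed.

Fact fps_mulVx : {in fps_unit, left_inverse 1 fps_inv *%R}.
Proof.
move=> s sU; rewrite /fps_inv sU mulrC; apply: fpsP => -[|n].
  by rewrite fps_coefM big_ord1 /= divrr.
rewrite fps_coefM big_ord_recl /= mulrN mulrA divrr // mul1r.
rewrite [X in - X + _ = _](eq_bigr (fun i : 'I_n.+1 =>
  s i.+1 * (fps_inv_seq s (n - i))`_0)).
  by rewrite addNr.
by move=> i _; rewrite (fps_inv_seqE _ (_ : i <= n)%N) // -ltnS.
Qed.

Fact fps_unitPl s t : t * s = 1 -> fps_unit s.
Proof.
move=> /(congr1 (fun u : fps R => u 0%N)); rewrite fps_coefM big_ord1 /= => ts1.
by apply/unitrP; exists (t 0%N); rewrite [s _ * _]mulrC.
Qed.

Fact fps_inv_out : {in [predC fps_unit], fps_inv =1 id}.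
Proof. by move=> s; rewrite inE /= /fps_inv => /negbTE ->. Qed.

HB.instance Definition _ := GRing.ComNzRing_hasMulInverse.Build (fps R)
  fps_mulVx fps_unitPl fps_inv_out.

Lemma fps_unitE s : (s \is a GRing.unit) = (s 0%N \is a GRing.unit).
Proof. by []. Qed.

End FpsUnit.

(* (a; q)_k *)
Definition qpoch (A : comNzRingType) (a q : A) (k : nat) : A :=
  \prod_(i < k) (1 - a * q ^+ i).

(* The sum of prod_(1 <= l <= r) q^(i_l) / (1 - q^(i_l)) over the indices
   j >= i_1 >= ... >= i_r >= 1. *)
Fixpoint nested_sum (A : comUnitRingType) (q : A) (r j : nat) : A :=
  if r is r'.+1 then
    \sum_(1 <= i < j.+1) q ^+ i / (1 - q ^+ i) * nested_sum q r' i
  else 1.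

(* Main.v *)
(** Expand both sides in powers of [b], i.e. of [x = b q].  The q-binomial
    series [x^k / (x; q)_k = sum_(j >= k) [j-1, k-1]_q x^j] and the absorption
    rule [(1 - q^k) [j, k]_q = (1 - q^j) [j-1, k-1]_q] reduce the theorem to
    Dilcher's identity, which evaluates the nested sum of depth [r] at [n] as
    [sum_(1 <= k <= n) (-1)^(k-1) [n, k]_q q^(k(k-1)/2 + r k) / (1 - q^k)^r].
    The latter follows by induction on [r], then on [n]: the q-Pascal rule
    shows that both sides have the same increment in [n].  Truncated at
    [M], the two sides agree modulo [q^(M+1)]. *)
Require Import Defs.
From mathcomp Require Import all_boot all_order all_algebra.
From mathcomp Require Import ring zify.

Import GRing.Theory.
Local Open Scope ring_scope.

(** The Gaussian binomial; recursion by q-Pascal avoids quotients, so it makes sense in any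
    commutative ring. *)
Fixpoint qbinom {A : comNzRingType} (q : A) (n k : nat) : A :=
  match n, k with
  | _, 0%N => 1
  | 0%N, _.+1 => 0
  | n'.+1, k'.+1 => qbinom q n' k' + q ^+ k'.+1 * qbinom q n' k'.+1
  end.

Section QBinomial.
Context {A : comNzRingType}.
Implicit Types x q : A.

Lemma qbinom0 q n : qbinom q n 0 = 1.
Proof. by case: n. Qed.

Lemma qbinomS q n k :
  qbinom q n.+1 k.+1 = qbinom q n k + q ^+ k.+1 * qbinom q n k.+1.
Proof. by []. Qed.

Lemma qbinom_small q n k : (n < k)%N -> qbinom q n k = 0.
Proof.
elim: n k => [|n IHn] [|k] //= ltnk.
by rewrite !IHn ?mulr0 ?addr0 //; apply: ltnW.
Qed.

(* The dual Pascal rule, multiplied by [q ^+ k] to avoid the truncated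
   exponent [n - k]. *)
Lemma qbinom_pascal_dual q n k :
  q ^+ k * (qbinom q n.+1 k.+1 - qbinom q n k.+1) = q ^+ n * qbinom q n k.
Proof.
elim: n k => [|n IHn] k.
  by case: k => [|k]; rewrite /= ?(mulr0, addr0, subr0, expr0, mulr1).
rewrite qbinomS [X in _ - X]qbinomS.
case: k => [|k].
  have IH0 := IHn 0%N; rewrite !qbinom0 in IH0 *.
  transitivity (q * (q ^+ 0 * (qbinom q n.+1 1 - qbinom q n 1))).
    by rewrite !expr0; ring.
  by rewrite IH0 exprS; ring.
transitivity (q * (q ^+ k * (qbinom q n.+1 k.+1 - qbinom q n k.+1)) +
    q ^+ k.+2 * (q ^+ k.+1 * (qbinom q n.+1 k.+2 - qbinom q n k.+2))).
  by rewrite !exprS; ring.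
by rewrite !IHn [X in _ = _ * X]qbinomS !exprS; ring.
Qed.

(** Subtracting [q] times the dual Pascal rule from the q-Pascal rule leaves exactly this. *)
Lemma qbinom_absorb q n k :
  (1 - q ^+ k.+1) * qbinom q n.+1 k.+1 = (1 - q ^+ n.+1) * qbinom q n k.
Proof.
transitivity (qbinom q n.+1 k.+1 - q ^+ k.+1 * qbinom q n k.+1 -
    q * (q ^+ k * (qbinom q n.+1 k.+1 - qbinom q n k.+1))).
  by rewrite exprS; ring.
by rewrite qbinom_pascal_dual qbinomS !exprS; ring.
Qed.

Lemma qbinom_alternating_sum q n N : (n < N)%N ->
  \sum_(0 <= k < N) (-1) ^+ k * qbinom q n.+1 k.+1 * q ^+ 'C(k.+1, 2) = 1.
Proof.
move=> ltnN.
(* By q-Pascal the summand is [t k.+1 - t k]; [t N] vanishes since [n < N], and [t 0] is -1. *)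
pose t k := - ((-1) ^+ k * q ^+ 'C(k.+1, 2) * qbinom q n k).
rewrite (eq_big_nat _ _ (F2 := fun k => t k.+1 - t k)); last first.
  move=> k _; rewrite /t qbinomS [in RHS]binS bin1 exprD !exprS; ring.
rewrite telescope_sumr // /t qbinom_small // qbinom0 expr0 expr0.
by rewrite !mulr0 !mulr1 oppr0 sub0r opprK.
Qed.

(** Truncated expansion of [x ^+ k.+1 / qpoch x q k.+1] with the denominator cleared; the base case
    is a geometric sum. *)
Lemma qbinom_series x q k M :
  exists e, qpoch x q k.+1 * (\sum_(0 <= j < M) x ^+ j.+1 * qbinom q j k)
    = x ^+ k.+1 + x ^+ M.+1 * e.
Proof.
elim: k => [|k [e IHk]].
  exists (-1); rewrite /qpoch big_ord1 expr0 mulr1.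
  elim: M => [|M IHM]; first by rewrite big_nil; ring.
  by rewrite big_nat_recr //= mulrDr IHM qbinom0 !exprS; ring.
exists (x * e - qpoch x q k.+1 * qbinom q M k.+1).
(* By q-Pascal, the new factor of the Pochhammer symbol lowers [k.+1] to [k], at the cost of a
   boundary term at [M]. *)
have step : (1 - x * q ^+ k.+1) *
    (\sum_(0 <= j < M) x ^+ j.+1 * qbinom q j k.+1) =
    x * (\sum_(0 <= j < M) x ^+ j.+1 * qbinom q j k) -
    x ^+ M.+1 * qbinom q M k.+1.
  elim: M {e IHk} => [|M IHM]; first by rewrite !big_nil /=; ring.
  by rewrite !big_nat_recr //= !mulrDr IHM !exprS; ring.
rewrite /qpoch big_ord_recr -/(qpoch x q k.+1) /= -mulrA step mulrBr.
rewrite mulrCA IHk [x ^+ k.+2]exprS; ring.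
Qed.

End QBinomial.

Lemma sum_congr_mod {A : comNzRingType} (p : A) (F G : nat -> A) N :
  (forall k, exists e, F k = G k + p * e) ->
  exists e, \sum_(0 <= k < N) F k = \sum_(0 <= k < N) G k + p * e.
Proof.
move=> FG; elim: N => [|N [e IHN]].
  by exists 0; rewrite !big_nil mulr0 addr0.
have [e' FGN] := FG N; exists (e + e').
by rewrite !big_nat_recr //= IHN FGN; ring.
Qed.

Section Dilcher.
Context {A : comUnitRingType} {q : A}.
Hypothesis qU : forall i, (0 < i)%N -> 1 - q ^+ i \is a GRing.unit.

Lemma qbinom_absorb_div n k :
  qbinom q n.+1 k.+1 / (1 - q ^+ n.+1) = qbinom q n k / (1 - q ^+ k.+1).
Proof.
have Uk := qU k.+1 isT; have Un := qU n.+1 isT.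
apply: (mulIr Uk); apply: (mulIr Un).
by rewrite mulrAC !divrK // mulrC qbinom_absorb mulrC.
Qed.

(** Terms with [k > n] vanish, so [N] can stay fixed while [n] varies: sums for successive [n]
    subtract termwise, and the double sum below can be exchanged. *)
Lemma dilcher_identity r n N : (n < N)%N ->
  nested_sum q r n.+1 =
  \sum_(0 <= k < N) (-1) ^+ k * qbinom q n.+1 k.+1 *
    (q ^+ ('C(k.+1, 2) + r * k.+1) / (1 - q ^+ k.+1) ^+ r).
Proof.
elim: r n N => [|r IHr] n N ltnN /=.
  rewrite -[LHS](qbinom_alternating_sum q n N ltnN).
  by apply: eq_bigr => k _; rewrite mul0n addn0 expr0 divr1.
pose D n := \sum_(0 <= k < N) (-1) ^+ k * qbinom q n k.+1 *
    (q ^+ ('C(k.+1, 2) + r.+1 * k.+1) / (1 - q ^+ k.+1) ^+ r.+1).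
have D0 : D 0%N = 0 by rewrite /D big1 // => k _; rewrite /= mulr0 mul0r.
have DS i : (i < N)%N ->
    D i.+1 = D i + q ^+ i.+1 / (1 - q ^+ i.+1) * nested_sum q r i.+1.
  move=> ltiN; apply/eqP; rewrite addrC -subr_eq; apply/eqP.
  rewrite (IHr i N) // /D -sumrB mulr_sumr; apply: eq_bigr => k _.
  have absorb := qbinom_absorb_div i k.
  (* The dual Pascal rule uses up the factor [q ^+ k] and yields [q ^+ i]; absorption then trades
     one denominator [1 - q ^+ k.+1] for [1 - q ^+ i.+1]. *)
  have -> : q ^+ ('C(k.+1, 2) + r.+1 * k.+1) =
      q ^+ k * (q * q ^+ ('C(k.+1, 2) + r * k.+1)).
    by rewrite -exprS -exprD; congr (_ ^+ _); lia.
  rewrite [X in _ / X]exprS invrM ?unitrX ?qU //.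
  have P := qbinom_pascal_dual q i k.
  rewrite [q ^+ i.+1]exprS in absorb *.
  set v := (1 - q ^+ k.+1)^-1 in absorb *.
  set u := _^-1; set c := q ^+ ('C(_, _) + _).
  transitivity ((-1) ^+ k * (q ^+ k * (qbinom q i.+1 k.+1 - qbinom q i k.+1))
     * q * c * u * v); first by ring.
  rewrite P.
  transitivity ((-1) ^+ k * q ^+ i * (qbinom q i k * v) * q * c * u);
    first by ring.
  by rewrite -absorb; ring.
rewrite -/(D n.+1) big_add1 /=.
elim: n ltnN => [|n IHn] ltnN.
  by rewrite big_nat1 DS // D0 add0r.
by rewrite big_nat_recr //= IHn ?DS // ltnW.
Qed.

Lemma partial_sums_congr (b : A) r M :
  (forall k, qpoch (b * q) q k \is a GRing.unit) ->
  exists e,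
    \sum_(1 <= k < M.+1)
      (-1) ^+ (k - 1) * (b ^+ k * q ^+ ((k * (k + 1)) %/ 2 + r * k)) /
      (qpoch (b * q) q k * (1 - q ^+ k) ^+ r.+1)
    = \sum_(1 <= j < M.+1) b ^+ j * q ^+ j / (1 - q ^+ j) * nested_sum q r j
      + q ^+ M.+1 * e.
Proof.
move=> pU; set x := b * q in pU *.
(* [H k] truncates [x ^+ k.+1 / qpoch x q k.+1], and [c k] is the rest of the left-hand term of
   index [k.+1]. The right side equals the sum of [c k * H k] exactly, the left side only modulo
   [q ^+ M.+1]. *)
pose c k := (-1) ^+ k * q ^+ ('C(k.+1, 2) + r * k.+1) /
  (1 - q ^+ k.+1) ^+ r.+1.
pose H k := \sum_(0 <= j < M) x ^+ j.+1 * qbinom q j k.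
have rhsE : \sum_(1 <= j < M.+1)
    b ^+ j * q ^+ j / (1 - q ^+ j) * nested_sum q r j
    = \sum_(0 <= k < M) c k * H k.
  rewrite big_add1 /=.
  under [RHS]eq_bigr do rewrite mulr_sumr.
  rewrite exchange_big /=; apply: eq_big_nat => j /andP[_ ltjM].
  rewrite (dilcher_identity r j M ltjM) mulr_sumr.
  apply: eq_bigr => k _; rewrite /c -exprMn -/x.
  rewrite [X in _ = _ / X * _]exprS invrM ?unitrX ?qU //.
  set u := ((1 - q ^+ k.+1) ^+ r)^-1.
  transitivity (x ^+ j.+1 * (-1) ^+ k * q ^+ ('C(k.+1, 2) + r * k.+1) * u *
     (qbinom q j.+1 k.+1 / (1 - q ^+ j.+1))); first by ring.
  by rewrite qbinom_absorb_div; ring.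
have lhsE k : exists e,
    (-1) ^+ (k.+1 - 1) *
      (b ^+ k.+1 * q ^+ ((k.+1 * (k.+1 + 1)) %/ 2 + r * k.+1)) /
      (qpoch x q k.+1 * (1 - q ^+ k.+1) ^+ r.+1)
    = c k * H k + q ^+ M.+1 * e.
  have [e He] := qbinom_series x q k M.
  exists (- (c k * b ^+ M.+1 * e / qpoch x q k.+1)).
  (* The split-off [q ^+ k.+1] joins [b ^+ k.+1] to form [x ^+ k.+1]. *)
  have -> : ((k.+1 * (k.+1 + 1)) %/ 2 = 'C(k.+1, 2) + k.+1)%N.
    by rewrite addn1 mulnC divn2 -bin2 binS bin1.
  rewrite subn1 /= invrM ?unitrX ?qU //.
  apply: (mulIr (pU k.+1)); rewrite [_ * (_^-1 / _)]mulrA divrK //.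
  rewrite mulrDl mulrN mulNr -[q ^+ M.+1 * _ * _]mulrA divrK //.
  rewrite -[c k * H k * _]mulrA [H k * _]mulrC He /c !exprD.
  rewrite [x ^+ k.+1]exprMn [x ^+ M.+1]exprMn.
  ring.
rewrite rhsE big_add1 /=.
exact: sum_congr_mod.
Qed.

End Dilcher.

Section PowerSeries.
Context {R : comUnitRingType}.
Implicit Types s : fps R.

Lemma fps_coefXnM s N n : (n < N)%N -> (fpsX ^+ N * s) n = 0.
Proof.
elim: N n => // N IHN n; rewrite ltnS => lenN.
rewrite exprS -mulrA fps_coefM big1 // => i _.
rewrite [fpsX i]/=; have [i1|_] := eqVneq (i : nat) 1%N; last by rewrite mul0r.
by rewrite IHN ?mulr0 //; have := ltn_ord i; lia.
Qed.

Lemma fps_coefD s t n : (s + t) n = s n + t n.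
Proof. by []. Qed.

(** Terms of index above [n] do not reach coefficient [n], so it can be read off the [n]-th partial
    sum. *)
Lemma fps_is_sum1_XnM (u : nat -> fps R) :
  fps_is_sum1 (fun k => fpsX ^+ k * u k)
    (Fps (fun n => (\sum_(1 <= k < n.+1) fpsX ^+ k * u k) n)).
Proof.
move=> n; exists n => M lenM.
elim: M lenM => [|M IHM].
  by rewrite leqn0 => /eqP ->.
rewrite leq_eqVlt => /predU1P[-> // | ltnM].
by rewrite big_nat_recr // fps_coefD IHM // fps_coefXnM ?addr0.
Qed.

Lemma fps_unit_1BXM s N : (0 < N)%N ->
  (1 - s * fpsX ^+ N : fps R) \is a GRing.unit.
Proof.
move=> N_gt0; rewrite fps_unitE mulrC.
have -> : (1 - fpsX ^+ N * s) 0%N = (1 : fps R) 0%N - (fpsX ^+ N * s) 0%N by [].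
by rewrite fps_coefXnM // subr0 unitr1.
Qed.

End PowerSeries.

Theorem theorem4p4 (R : idomainType) (m : nat) (hm : (0 < m)%N) :
  let q : fps {poly R} := fpsX in
  let b : fps {poly R} := fpsC 'X in
  exists S : fps {poly R},
    fps_is_sum1 (fun k =>
      (-1) ^+ (k - 1) *
      (b ^+ k * q ^+ ((k * (k + 1)) %/ 2 + (m - 1) * k)) /
      (qpoch (b * q) q k * (1 - q ^+ k) ^+ m)) S
    /\
    fps_is_sum1 (fun j =>
      b ^+ j * q ^+ j / (1 - q ^+ j) * nested_sum q (m - 1) j) S.
Proof.
move=> q b.
pose u j := b ^+ j / (1 - q ^+ j) * nested_sum q (m - 1) j.
have uE : (fun j => b ^+ j * q ^+ j / (1 - q ^+ j) * nested_sum q (m - 1) j)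
    = (fun j => q ^+ j * u j).
  by apply: boolp.funext => j; rewrite /u; ring.
have sumU := fps_is_sum1_XnM u; rewrite -uE in sumU.
set S := Fps _ in sumU; exists S; split=> // n.
(* Beyond [K] the right-hand partial sums have settled at coefficient [n]; beyond [n] the error, a
   multiple of [q ^+ M.+1], no longer touches it. *)
have [K SK] := sumU n; exists (maxn K n) => M.
rewrite geq_max => /andP[leKM lenM].
have qU i : (0 < i)%N -> 1 - q ^+ i \is a GRing.unit.
  by move=> i_gt0; rewrite -[q ^+ i]mul1r fps_unit_1BXM.
have pU k : qpoch (b * q) q k \is a GRing.unit.
  rewrite /qpoch; apply: (big_ind (fun s => s \is a GRing.unit)) => //.
  - exact: unitr1.
  - by move=> s t sU tU; rewrite unitrM sU.
  - by move=> i _; rewrite -mulrA -exprS fps_unit_1BXM.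
have [e] := partial_sums_congr qU b (m - 1) M pU.
have -> : (m - 1).+1 = m by rewrite subn1 prednK.
by move=> ->; rewrite fps_coefD SK // fps_coefXnM ?addr0.
Qed.
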